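(* Let a (nondegenerate) triangle $ABC$ in the Euclidean plane have sidelengths $a=|BC|$, $b=|CA|$, $c=|AB|$, and let $\theta,\varphi,\omega$ be the degree measures of its interior angles at $A$, $B$, $C$ respectively (so $\theta,\varphi,\omega$ are opposite the sides of length $a,b,c$ respectively). Put $$v=\cot\left(\frac{\omega}{2}\right)\cdot\frac{a-b}{a+b},$$ and let $t$ be the unique degree measure with $-90<t<90$ and $\tan t=v$. Then $$\theta = 90+t-\frac{\omega}{2},\qquad \varphi = 90-\left(t+\frac{\omega}{2}\right),$$ and $$c=\frac{a\sin\omega}{\sin\theta}=\frac{b\sin\omega}{\sin\varphi}.$$
   Context: All angles are measured in degrees, and the trigonometric functions $\sin,\tan,\cot$ are evaluated at angles given in degrees. *)

(* Defs.v *)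
From Stdlib Require Export Reals.
Open Scope R_scope.

Definition point : Type := (R * R)%type.

Definition distance (P Q : point) : R :=
  dist_euc (fst P) (snd P) (fst Q) (snd Q).

(* P, Q and S lie on a common line l x + m y = n *)
Definition collinear (P Q S : point) : Prop :=
  exists l m n : R, (l <> 0 \/ m <> 0) /\
    l * fst P + m * snd P = n /\
    l * fst Q + m * snd Q = n /\
    l * fst S + m * snd S = n.

(* dot product of the vectors QP and QS *)
Definition dot_at (P Q S : point) : R :=
  (fst P - fst Q) * (fst S - fst Q) + (snd P - snd Q) * (snd S - snd Q).

(* Degree measure, in [0, 180], of the angle PQS with vertex Q; meaningful
   only when Q differs from both P and S. *)
Definition angle_deg (P Q S : point) : R :=
  toDeg (acos (dot_at P Q S / (distance Q P * distance Q S))).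

(* Companion of the standard library's sind, cosd and tand, whose argument
   is in degrees. *)
Definition cotd (x : R) : R := cosd x / sind x.

(* Main.v *)
Require Import Defs.
From Stdlib Require Import Reals.
From Stdlib Require Import Lra.
Open Scope R_scope.

(** Writing [K] for twice the area, each angle has sine [K] over the product of
    its two adjacent sides, which is the law of sines, and cosine the dot product
    over the same product; the addition formulas then give the angle sum 180.
    Sum-to-product turns [(a - b) / (a + b) = (sin theta - sin phi) / (sin theta + sin phi)]
    into [tan ((theta - phi) / 2) * tan (omega / 2)], so [t = (theta - phi) / 2]. *)

(** Absolute value of the cross product of [QP] and [QS]. Dropping the orientation lets one positive
    number [K] serve at all three vertices. *)
Definition double_area (P Q S : point) : R :=
  Rabs ((fst P - fst Q) * (snd S - snd Q) - (snd P - snd Q) * (fst S - fst Q)).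

Lemma double_area_sym (P Q S : point) : double_area S Q P = double_area P Q S.
Proof.
unfold double_area; rewrite <- Rabs_Ropp; f_equal; ring.
Qed.

Lemma double_area_rot (P Q S : point) : double_area Q S P = double_area P Q S.
Proof.
unfold double_area; f_equal; ring.
Qed.

Lemma distance_comm (P Q : point) : distance P Q = distance Q P.
Proof.
apply distance_symm.
Qed.

Lemma distance_sqr (P Q : point) :
  distance P Q * distance P Q =
  (fst P - fst Q) * (fst P - fst Q) + (snd P - snd Q) * (snd P - snd Q).
Proof.
unfold distance, dist_euc; rewrite sqrt_sqrt; [reflexivity|].
apply Rplus_le_le_0_compat; apply Rle_0_sqr.
Qed.

Lemma distance_pos (P Q : point) : P <> Q -> 0 < distance P Q.
Proof.
intros hPQ.
destruct (sqrt_pos (Rsqr (fst P - fst Q) + Rsqr (snd P - snd Q))) as [h|h];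
  [exact h|exfalso; apply hPQ].
assert (h2 := distance_sqr P Q).
unfold distance, dist_euc in h2; rewrite <- h in h2.
destruct P as [p1 p2], Q as [q1 q2]; simpl in *.
assert (p1 - q1 = 0 /\ p2 - q2 = 0) as [h3 h4] by (apply Rplus_sqr_eq_0; unfold Rsqr; lra).
f_equal; lra.
Qed.

Lemma not_collinear_rot (P Q S : point) :
  ~ collinear P Q S -> ~ collinear Q S P.
Proof.
intros h (l & m & n & hlm & h1 & h2 & h3); apply h; exists l, m, n; tauto.
Qed.

Lemma not_collinear_sym (P Q S : point) :
  ~ collinear P Q S -> ~ collinear S Q P.
Proof.
intros h (l & m & n & hlm & h1 & h2 & h3); apply h; exists l, m, n; tauto.
Qed.

(** A zero cross product yields a common line: [PQ] if these points differ, else [QS], or the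
    vertical line through [Q] when [S] has the same abscissa. *)
Lemma double_area_pos (P Q S : point) :
  ~ collinear P Q S -> 0 < double_area P Q S.
Proof.
intros h; apply Rabs_pos_lt; intros h0; apply h.
destruct (Req_dec (fst P) (fst Q)) as [e1|n1];
  [destruct (Req_dec (snd P) (snd Q)) as [e2|n2];
   [destruct (Req_dec (fst S) (fst Q)) as [e3|n3]|]|].
- exists 1, 0, (fst Q); repeat split; lra.
- exists (snd S - snd Q), (- (fst S - fst Q)),
    ((snd S - snd Q) * fst Q - (fst S - fst Q) * snd Q).
  rewrite e1, e2; repeat split; [right; lra|ring..].
- exists (snd P - snd Q), (- (fst P - fst Q)),
    ((snd P - snd Q) * fst Q - (fst P - fst Q) * snd Q).
  repeat split; [left; lra|ring|ring|lra].
- exists (snd P - snd Q), (- (fst P - fst Q)),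
    ((snd P - snd Q) * fst Q - (fst P - fst Q) * snd Q).
  repeat split; [right; lra|ring|ring|lra].
Qed.

Lemma not_collinear_distance_pos (P Q S : point) :
  ~ collinear P Q S -> 0 < distance P Q.
Proof.
intros h; apply distance_pos; intros e.
assert (hK := double_area_pos P Q S h).
unfold double_area in hK; rewrite e in hK.
rewrite !Rminus_diag, !Rmult_0_l, Rminus_diag, Rabs_R0 in hK; lra.
Qed.

(** Lagrange's identity for the vectors [QP] and [QS]; it makes the two quotients by [QP * QS] a
    cosine and a sine. *)
Lemma dot_sqr_double_area (P Q S : point) :
  dot_at P Q S * dot_at P Q S + double_area P Q S * double_area P Q S =
  (distance Q P * distance Q S) * (distance Q P * distance Q S).
Proof.
replace (distance Q P * distance Q S * (distance Q P * distance Q S))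
  with (distance Q P * distance Q P * (distance Q S * distance Q S)) by ring.
rewrite !distance_sqr; unfold dot_at, double_area.
rewrite <- Rabs_mult, Rabs_pos_eq by apply Rle_0_sqr; ring.
Qed.

Lemma acos_quotient (d s r : R) : 0 < s -> 0 < r -> d * d + s * s = r * r ->
  0 < acos (d / r) < PI /\ cos (acos (d / r)) = d / r /\ sin (acos (d / r)) = s / r.
Proof.
intros hs hr h.
assert (hsr : 0 < s / r) by (apply Rdiv_lt_0_compat; lra).
assert (h1 : 1 - Rsqr (d / r) = Rsqr (s / r)).
{ unfold Rsqr.
  replace 1 with (r * r / (r * r)) by (field; lra).
  rewrite <- h at 1; field; lra. }
(* Strict since [s / r] is positive; this keeps the angle away from [0] and [PI]. *)
assert (hd : -1 < d / r < 1) by (unfold Rsqr in h1; nra).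
repeat split; try apply (acos_bound_lt _ hd).
- apply cos_acos; lra.
- rewrite sin_acos by lra; rewrite h1; apply sqrt_Rsqr; lra.
Qed.

Lemma toRad_angle_deg (P Q S : point) : ~ collinear P Q S ->
  0 < toRad (angle_deg P Q S) < PI /\
  cos (toRad (angle_deg P Q S)) = dot_at P Q S / (distance Q P * distance Q S) /\
  sin (toRad (angle_deg P Q S)) = double_area P Q S / (distance Q P * distance Q S).
Proof.
intros h; unfold angle_deg; rewrite rad_deg.
apply acos_quotient.
- now apply double_area_pos.
- apply Rmult_lt_0_compat.
  + rewrite distance_comm; now apply (not_collinear_distance_pos P Q S).
  + apply (not_collinear_distance_pos Q S P); now apply not_collinear_rot.
- apply dot_sqr_double_area.
Qed.

(** The sine hypothesis excludes [x + y > PI], where the sine would be negative; then [x + y] and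
    [PI - z] both lie where the cosine is injective. *)
Lemma sum_angles_pi (x y z : R) : 0 < x < PI -> 0 < y < PI -> 0 < z < PI ->
  cos (x + y) = - cos z -> sin (x + y) = sin z -> x + y + z = PI.
Proof.
intros hx hy hz hc hs.
assert (hsz : 0 < sin z) by (apply sin_gt_0; lra).
assert (hlt : x + y <= PI).
{ destruct (Rle_or_lt (x + y) PI) as [h|h]; [exact h|].
  assert (sin (x + y) < 0) by (apply sin_lt_0; lra); lra. }
enough (x + y = PI - z) by lra.
apply cos_inj; [lra|lra|].
rewrite hc, cos_minus, cos_PI, sin_PI; ring.
Qed.

(** Law of tangents, with [k] the common ratio of side to sine. As [z / 2] is the complement of
    [(x + y) / 2], its cotangent is [tan ((x + y) / 2)], which cancels against the sum-to-product
    quotient. *)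
Lemma mollweide_tan (x y z k : R) : 0 < k ->
  0 < x < PI -> 0 < y < PI -> 0 < z -> x + y + z = PI ->
  tan ((x - y) / 2) =
  cos (z / 2) / sin (z / 2) *
  ((k * sin x - k * sin y) / (k * sin x + k * sin y)).
Proof.
intros hk hx hy hz hsum.
replace (z / 2) with (PI / 2 - (x + y) / 2) by lra.
rewrite cos_shift, sin_shift, <- Rmult_minus_distr_l, <- Rmult_plus_distr_l, form3, form4.
assert (0 < cos ((x - y) / 2)) by (apply cos_gt_0; lra).
assert (0 < cos ((x + y) / 2)) by (apply cos_gt_0; lra).
assert (0 < sin ((x + y) / 2)) by (apply sin_gt_0; lra).
unfold tan; field; lra.
Qed.

(** Brings the three vertices to one area [K] and one orientation of each side, so that later
    quotients cancel. *)
Lemma triangle_trig (A B C : point) : ~ collinear A B C ->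
  let K := double_area A B C in
  let a := distance B C in let b := distance C A in let c := distance A B in
  (0 < toRad (angle_deg B A C) < PI /\
   cos (toRad (angle_deg B A C)) = dot_at B A C / (c * b) /\
   sin (toRad (angle_deg B A C)) = K / (c * b)) /\
  (0 < toRad (angle_deg C B A) < PI /\
   cos (toRad (angle_deg C B A)) = dot_at C B A / (a * c) /\
   sin (toRad (angle_deg C B A)) = K / (a * c)) /\
  (0 < toRad (angle_deg A C B) < PI /\
   cos (toRad (angle_deg A C B)) = dot_at A C B / (b * a) /\
   sin (toRad (angle_deg A C B)) = K / (b * a)).
Proof.
intros h K a b c.
assert (hB := not_collinear_sym _ _ _ h).
assert (hA := not_collinear_rot _ _ _ hB).
assert (hC := not_collinear_rot _ _ _ hA).
assert (hBA : double_area B A C = K)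
  by (now rewrite double_area_sym, 2!double_area_rot).
assert (hCB : double_area C B A = K) by apply double_area_sym.
assert (hAC : double_area A C B = K)
  by (now rewrite double_area_sym, double_area_rot).
pose proof (toRad_angle_deg _ _ _ hA) as tA.
pose proof (toRad_angle_deg _ _ _ hB) as tB.
pose proof (toRad_angle_deg _ _ _ hC) as tC.
rewrite hBA, (distance_comm A C) in tA.
rewrite hCB, (distance_comm B A) in tB.
rewrite hAC, (distance_comm C B) in tC.
exact (conj tA (conj tB tC)).
Qed.

Lemma triangle_angle_sum (A B C : point) : ~ collinear A B C ->
  toRad (angle_deg B A C) + toRad (angle_deg C B A) + toRad (angle_deg A C B) = PI.
Proof.
intros h.
assert (ha : 0 < distance B C).
{ apply (not_collinear_distance_pos B C A); now apply not_collinear_rot. }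
assert (hb : 0 < distance C A).
{ apply (not_collinear_distance_pos C A B); now do 2 apply not_collinear_rot. }
assert (hc := not_collinear_distance_pos A B C h).
assert (hc2 := distance_sqr A B).
destruct (triangle_trig A B C h)
  as ((hx & cx & sx) & (hy & cy & sy) & (hz & cz & sz)).
(* This is [cos (x + y) = - cos z] with denominators cleared. *)
assert (hK : double_area A B C * double_area A B C =
  dot_at B A C * dot_at C B A
  + dot_at A C B * (distance A B * distance A B)).
{ unfold double_area; rewrite <- Rabs_mult, Rabs_pos_eq by apply Rle_0_sqr.
  rewrite hc2; unfold dot_at; ring. }
(* The projections of [AC] and [CB] onto [AB] add up to [AB]; this is what the sine of the sum
   needs. *)
assert (hdot : dot_at B A C + dot_at C B A = distance A B * distance A B)
  by (rewrite hc2; unfold dot_at; ring).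
apply sum_angles_pi; trivial.
- rewrite cos_plus, cx, cy, cz, sx, sy.
  transitivity ((dot_at B A C * dot_at C B A
                 - double_area A B C * double_area A B C)
                / (distance A B * distance A B * distance B C * distance C A)).
  { field; lra. }
  rewrite hK; field; lra.
- rewrite sin_plus, cx, cy, sz, sx, sy.
  transitivity (double_area A B C * (dot_at B A C + dot_at C B A)
                / (distance A B * distance A B * distance B C * distance C A)).
  { field; lra. }
  rewrite hdot; field; lra.
Qed.

Lemma toRad_bound (s : R) : -90 < s < 90 <-> - (PI / 2) < toRad s < PI / 2.
Proof.
assert (hpi := PI_RGT_0).
unfold toRad, plat; replace (s * PI * / 180) with (PI * (s / 180)) by field.
split; intros [h1 h2]; split; nra.
Qed.

Lemma tand_inj (s t : R) : -90 < s < 90 -> -90 < t < 90 -> tand s = tand t -> s = t.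
Proof.
intros hs ht h; apply toRad_inj, tan_inj; trivial; rewrite Rdiv_opp_l;
  now apply toRad_bound.
Qed.

Theorem mainTheorem1 (A B C : point) (hABC : ~ collinear A B C)
  (a b c theta phi omega v : R)
  (ha : a = distance B C) (hb : b = distance C A) (hc : c = distance A B)
  (htheta : theta = angle_deg B A C)
  (hphi : phi = angle_deg C B A)
  (homega : omega = angle_deg A C B)
  (hv : v = cotd (omega / 2) * ((a - b) / (a + b))) :
  exists t : R,
    unique (fun s : R => -90 < s < 90 /\ tand s = v) t /\
    theta = 90 + t - omega / 2 /\
    phi = 90 - (t + omega / 2) /\
    c = a * sind omega / sind theta /\
    c = b * sind omega / sind phi.
Proof.
assert (ap : 0 < a).
{ rewrite ha; apply (not_collinear_distance_pos B C A); now apply not_collinear_rot. }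
assert (bp : 0 < b).
{ rewrite hb; apply (not_collinear_distance_pos C A B); now do 2 apply not_collinear_rot. }
assert (cp : 0 < c) by (rewrite hc; now apply (not_collinear_distance_pos A B C)).
assert (Kp := double_area_pos A B C hABC).
assert (hpi := PI_RGT_0).
pose proof (triangle_angle_sum A B C hABC) as hsum.
destruct (triangle_trig A B C hABC)
  as ((hx & _ & sx) & (hy & _ & sy) & (hz & _ & sz)).
rewrite <- ?ha, <- ?hb, <- ?hc, <- ?htheta, <- ?hphi, <- ?homega in *.
set (K := double_area A B C) in *.
assert (hdeg : theta + phi + omega = 180).
{ apply toRad_inj; transitivity PI; [rewrite <- hsum|]; unfold toRad, plat; field. }
assert (hhalf : toRad ((theta - phi) / 2) = (toRad theta - toRad phi) / 2)
  by (unfold toRad, plat; field).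
assert (ht : -90 < (theta - phi) / 2 < 90 /\ tand ((theta - phi) / 2) = v).
{ split; [apply toRad_bound; rewrite hhalf; lra|].
  unfold tand; rewrite hhalf, hv; unfold cotd, cosd, sind.
  replace (toRad (omega / 2)) with (toRad omega / 2) by (unfold toRad, plat; field).
  (* The ratio [a * b * c / K] is the circumdiameter: times [sin theta = K / (c * b)] it gives [a],
     and likewise [b] from [phi]. *)
  rewrite (mollweide_tan _ _ (toRad omega) (a * b * c / K));
    [|apply Rdiv_lt_0_compat; [repeat apply Rmult_lt_0_compat|]|..]; try tauto.
  rewrite sx, sy; f_equal; field; repeat split; try lra.
  all: nra. }
exists ((theta - phi) / 2); repeat split.
1-3: apply ht.
- intros s [hs1 hs2]; apply tand_inj; [apply ht|exact hs1|].
  now rewrite hs2; apply ht.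
(* Half the difference of [theta] and [phi] plus or minus half their sum, which is [90 - omega / 2]
   by the angle sum. *)
- lra.
- lra.
(* Law of sines: [K] cancels between the two sines. *)
- unfold sind; rewrite sx, sz; field; lra.
- unfold sind; rewrite sy, sz; field; lra.
Qed.
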